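(* Let $\mu\le\lambda$ be infinite cardinals, $I=\lambda$, and let $\mathfrak{B}$ be a $\mu^+$-c.c. complete Boolean algebra of cardinality $\le 2^\lambda$. Then there exist a regular $\lambda^+$-excellent filter $\mathcal{D}$ on $\lambda$ and a surjective homomorphism $\mathbf{j}:\mathcal{P}(I)\to\mathfrak{B}$ such that $\mathcal{D}=\mathbf{j}^{-1}(\{1_{\mathfrak{B}}\})$.
   Context: Filters are proper and Boolean algebras nontrivial. $[\lambda]^{<\aleph_0}$ is the set of finite subsets of $\lambda$. $\mathfrak{B}$ is $\mu^+$-c.c. if every antichain (set of pairwise disjoint nonzero elements) has size $\le\mu$. A filter on $I$, $|I|=\lambda$, is regular if it contains sets $X_i$ $(i<\lambda)$ such that each $t\in I$ lies in only finitely many $X_i$. For $A,B\subseteq I$, $A=B\bmod\mathcal{D}$ means that $A$ and $B$ have the same image in $\mathcal{P}(I)/\mathcal{D}$. **Excellent.** For finite $u$, consider Boolean terms $\sigma=\sigma(\langle x_v:v\subseteq u\rangle)$ (in the language with $\cap,\cup,\le,-,0,1$) in variables indexed by subsets of $u$. For a Boolean algebra $\mathfrak{A}$ and $\overline a=\langle a_v:v\subseteq u\rangle$ in $\mathfrak{A}$, let $N(\overline a)$ be the set of all sequences $\langle a'_v:v\subseteq u\rangle$ such that for some $w\subseteq u$, $a'_v=a_v$ if $v\subseteq w$ and $a'_v=0_{\mathfrak{A}}$ otherwise. Let $\Lambda_{\mathfrak{A},\overline a}$ be the set of Boolean terms $\sigma(\langle x_v:v\subseteq u\rangle)$ such that $\sigma(\overline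 a')=0$ in $\mathfrak{A}$ for every $\overline a'\in N(\overline a)$. A filter $\mathcal{D}$ on $I$ is $\lambda^+$-excellent if for every sequence $\langle A_u:u\in[\lambda]^{<\aleph_0}\rangle$ of subsets of $I$ there is $\langle B_u:u\in[\lambda]^{<\aleph_0}\rangle$ such that for all $u\in[\lambda]^{<\aleph_0}$: $B_u\subseteq A_u$; $B_u=A_u\bmod\mathcal{D}$; and for every $\sigma\in\Lambda_{\mathcal{P}(I)/\mathcal{D},\langle A_v/\mathcal{D}:v\subseteq u\rangle}$, $\sigma(\langle B_v:v\subseteq u\rangle)=\emptyset$.
   Formalization: N(a) is taken to contain also the all-zero sequence; with N(a) as literally defined, u = ∅ and A_∅ ∈ D, A_∅ ≠ I would force B_∅ = I, so no regular filter on an infinite set could be excellent. *)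

(* Defs.v *)
From HB Require Import structures.
From mathcomp Require Import all_boot all_order finmap.
From mathcomp Require Import boolp classical_sets functions cardinality filter.

Set Implicit Arguments.
Unset Strict Implicit.
Unset Printing Implicit Defensive.

Import Order.TTheory.

Local Open Scope classical_set_scope.
Local Open Scope quotient_scope.

Section PowersetQuotient.
Variables (I : Type) (D : pfilter_on I).
Implicit Types A B C : set I.

Definition eqmod : rel (set I) := fun A B => `[< D [set t | A t <-> B t] >].

Lemma eqmodP A B : reflect (D [set t | A t <-> B t]) (eqmod A B).
Proof. exact: asboolP. Qed.

Lemma eqmod_refl : reflexive eqmod.
Proof. by move=> A; apply/eqmodP; apply: filterE. Qed.

Lemma eqmod_sym : symmetric eqmod.
Proof.
by move=> A B; apply/eqmodP/eqmodP; apply: filterS => t /=; tauto.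
Qed.

Lemma eqmod_trans : transitive eqmod.
Proof.
move=> B A C /eqmodP AB /eqmodP BC; apply/eqmodP.
by apply: filterS2 AB BC => t /=; tauto.
Qed.

Canonical eqmod_equiv := EquivRel eqmod eqmod_refl eqmod_sym eqmod_trans.

Definition powquot : Type := {eq_quot eqmod}.

HB.instance Definition _ := Choice.on powquot.
HB.instance Definition _ := EqQuotient.on powquot.

Definition modclass : set I -> powquot := \pi_powquot.

Lemma modclassP A B : reflect (D [set t | A t <-> B t]) (modclass A == modclass B).
Proof. by rewrite piE; apply: eqmodP. Qed.

Lemma modclassE A B : D [set t | A t <-> B t] -> modclass A = modclass B.
Proof. by move=> h; apply/eqP/modclassP. Qed.

Lemma reprE A : D [set t | repr (modclass A) t <-> A t].
Proof. by apply/modclassP; rewrite /modclass reprK. Qed.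

Lemma powquotW (P : powquot -> Prop) : (forall A, P (modclass A)) -> forall x, P x.
Proof. by move=> h x; rewrite -[x]reprK; apply: h. Qed.

Definition qmeet (x y : powquot) : powquot := modclass (repr x `&` repr y).
Definition qjoin (x y : powquot) : powquot := modclass (repr x `|` repr y).
Definition qcompl (x : powquot) : powquot := modclass (~` repr x).

Lemma qmeetE A B : qmeet (modclass A) (modclass B) = modclass (A `&` B).
Proof.
apply: modclassE; apply: filterS2 (reprE A) (reprE B) => t.
by rewrite /setI /=; tauto.
Qed.

Lemma qjoinE A B : qjoin (modclass A) (modclass B) = modclass (A `|` B).
Proof.
apply: modclassE; apply: filterS2 (reprE A) (reprE B) => t.
by rewrite /setU /=; tauto.
Qed.

Lemma qcomplE A : qcompl (modclass A) = modclass (~` A).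
Proof.
by apply: modclassE; apply: filterS (reprE A) => t; rewrite /setC /=; tauto.
Qed.

Definition qle (x y : powquot) : bool := qmeet x y == x.
Definition qlt (x y : powquot) : bool := (y != x) && qle x y.

Lemma qmeetC : commutative qmeet.
Proof. by elim/powquotW=> A; elim/powquotW=> B; rewrite !qmeetE setIC. Qed.

Lemma qjoinC : commutative qjoin.
Proof. by elim/powquotW=> A; elim/powquotW=> B; rewrite !qjoinE setUC. Qed.

Lemma qmeetA : associative qmeet.
Proof.
by elim/powquotW=> A; elim/powquotW=> B; elim/powquotW=> C; rewrite !qmeetE setIA.
Qed.

Lemma qjoinA : associative qjoin.
Proof.
by elim/powquotW=> A; elim/powquotW=> B; elim/powquotW=> C; rewrite !qjoinE setUA.
Qed.

Lemma qjoinKI (y x : powquot) : qmeet x (qjoin x y) = x.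
Proof.
by elim/powquotW: x => A; elim/powquotW: y => B; rewrite qjoinE qmeetE setUC setKU.
Qed.

Lemma qmeetKU (y x : powquot) : qjoin x (qmeet x y) = x.
Proof.
by elim/powquotW: x => A; elim/powquotW: y => B; rewrite qmeetE qjoinE setIC setKI.
Qed.

Lemma qmeetUl : left_distributive qmeet qjoin.
Proof.
elim/powquotW=> A; elim/powquotW=> B; elim/powquotW=> C.
by rewrite !(qmeetE, qjoinE) setIUl.
Qed.

Lemma qmeetxx : idempotent_op qmeet.
Proof. by elim/powquotW=> A; rewrite qmeetE setIid. Qed.

Fact powquot_display : Order.disp_t. Proof. exact: Order.Disp tt tt. Qed.

HB.instance Definition _ :=
  Order.isMeetJoinDistrLattice.Build powquot_display powquot
    (fun _ _ => erefl) (fun _ _ => erefl) qmeetC qjoinC qmeetA qjoinA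
    qjoinKI qmeetKU qmeetUl qmeetxx.

Lemma qle0x (x : powquot) : (modclass set0 <= x)%O.
Proof.
elim/powquotW: x => A; rewrite /Order.le /= /qle.
by rewrite qmeetE set0I.
Qed.

Lemma qlex1 (x : powquot) : (x <= modclass setT)%O.
Proof.
elim/powquotW: x => A; rewrite /Order.le /= /qle.
by rewrite qmeetE setIT.
Qed.

HB.instance Definition _ := Order.hasBottom.Build powquot_display powquot qle0x.
HB.instance Definition _ := Order.hasTop.Build powquot_display powquot qlex1.

Lemma qjoinxC (x : powquot) : Order.join x (qcompl x) = \top%O.
Proof.
by elim/powquotW: x => A; rewrite qcomplE [LHS]qjoinE setUv.
Qed.

Lemma qmeetxC (x : powquot) : Order.meet x (qcompl x) = \bot%O.
Proof.
by elim/powquotW: x => A; rewrite qcomplE [LHS]qmeetE setICr.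
Qed.

HB.instance Definition _ :=
  Order.TBDistrLattice_hasComplement.Build powquot_display powquot qjoinxC qmeetxC.

End PowersetQuotient.

Section BooleanAlgebras.
Variables (d : Order.disp_t) (B : ctbDistrLatticeType d).

(* ctbDistrLatticeType does not exclude the one-element algebra. *)
Definition nontrivial_ba : Prop := (\bot : B)%O <> \top%O.

Definition complete_ba : Prop :=
  forall S : set B, supremums S !=set0 /\ infimums S !=set0.

Definition antichain (S : set B) : Prop :=
  (forall x, S x -> x <> \bot%O) /\
  (forall x y, S x -> S y -> x <> y -> Order.meet x y = \bot%O).

(* The mu^+-c.c., where mu is the cardinality of M. *)
Definition succ_cc (M : Type) : Prop :=
  forall S : set B, antichain S -> (S #<= [set: M])%card.

End BooleanAlgebras.

Definition ba_morphism d d' (A : ctbDistrLatticeType d) (B : ctbDistrLatticeType d')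
    (f : A -> B) : Prop :=
  [/\ {morph f : x y / Order.meet x y}, {morph f : x y / Order.join x y},
      {morph f : x / Order.compl x}, f \bot%O = \bot%O & f \top%O = \top%O].

Section Terms.

(* "<=" is a relation symbol of the language, so it forms no terms. *)
Inductive bterm (V : Type) : Type :=
| BVar of V
| BBot
| BTop
| BMeet of bterm V & bterm V
| BJoin of bterm V & bterm V
| BCompl of bterm V.

Fixpoint beval (V : Type) d (A : ctbDistrLatticeType d) (a : V -> A)
    (s : bterm V) : A :=
  match s with
  | BVar v => a v
  | BBot => \bot%O
  | BTop => \top%O
  | BMeet s1 s2 => Order.meet (beval a s1) (beval a s2)
  | BJoin s1 s2 => Order.join (beval a s1) (beval a s2)
  | BCompl s1 => Order.compl (beval a s1)
  end.

End Terms.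

Section Excellent.
Local Open Scope fset_scope.

Section Lambda.
Variables (L : choiceType) (u : {fset L}) (d : Order.disp_t).
Variable A : ctbDistrLatticeType d.
Implicit Types (a : fpowerset u -> A) (w : {fset L}).

Definition truncation a w : fpowerset u -> A :=
  fun v => if val v `<=` w then a v else \bot%O.

(* N(a) contains the zero sequence besides the truncations of a. All truncations
   retain a_v at v = fset0, so without the zero sequence the term - x_fset0 would
   be in Lambda whenever A_fset0 is in D, forcing B_fset0 = I although
   B_fset0 is included in A_fset0: no regular filter on an infinite set would be
   excellent. The same effect is obtained by requiring A_fset0 = I, or by indexing
   by nonempty finite sets only. *)
Definition Nset a : set (fpowerset u -> A) :=
  [set a' | (exists2 w, w `<=` u & a' = truncation a w) \/ a' = fun=> \bot%O].

Definition Lambda a : set (bterm (fpowerset u)) :=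
  [set s | forall a', Nset a a' -> beval a' s = \bot%O].

End Lambda.

Variables (I : Type) (L : choiceType) (D : pfilter_on I).

Definition excellent : Prop :=
  forall A : {fset L} -> set I, exists B : {fset L} -> set I, forall u : {fset L},
    [/\ (B u `<=` A u)%classic,
        modclass D (B u) = modclass D (A u) &
        forall s, Lambda (fun v : fpowerset u => modclass D (A (val v))) s ->
          beval (fun v : fpowerset u => B (val v)) s = set0].

Definition regular : Prop :=
  exists X : L -> set I,
    (forall i, D (X i)) /\ (forall t, finite_set [set i | X i t]).

End Excellent.

Arguments excellent {I} L D.
Arguments regular {I} L D.

(* Main.v *)
Require Import Defs.
From mathcomp Require Import all_boot all_order finmap.
From mathcomp Require Import boolp classical_sets functions cardinality filter.
From mathcomp Require wochoice.
From Stdlib Require Wellfounded.Inverse_Image.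

(** The filter is built by transfinite induction, as in Kunen's construction of
good ultrafilters, with the values in B kept undecided at the start.

Excellence follows from goodness ([good_excellent]).  Given sets A u, call t
typical for u if the pattern of truth values of the A v, v <= u, at t is the
pattern at a D-positive set of points.  There are finitely many patterns, so
almost every t is typical for u.  Goodness provides finite sets w t such that t
is typical for w t and, for every v, almost all t have v <= w t; intersecting
A v with the set of those t gives the required B v, because a pattern that
occurs on a positive set cannot satisfy a term that vanishes modulo D.

The construction starts from a filter, sets X b (b in B) which represent B
modulo the filter, and 2^|L| functions from L to finite subsets of L, such that
a nonzero X b, finitely many prescribed values of the functions and a set of the
filter always have a common point ([base_represents], [base_independent]).  Each
stage extends the filter and gives up at most |L| of the functions, in such a
way that this independence persists for the others.  The task of a stage is a
family f of sets indexed by the finite subsets of L ([stage]).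

If every f v is consistent with the current filter and every condition on the
unused functions, then one unused function can serve as w: the points t with
v <= w t and t in f (w t) form a large set after an independent extension.
Otherwise a condition (b, e, h) forces a point out of some f v.  Then the
complement of f v is decided ([decide_step]): it is made equal to X b' for the
supremum b' of all elements which force it.  A maximal antichain of such
elements has the same supremum, has at most |L| members by the chain condition,
and only the functions in their finite conditions have to be given up.  As
b' is nonzero, f v is equal to some X c with c <> 1, so that f v is not in the
final filter.

The tasks number 2^|L|, and the stages are indexed by an initial well-order of
that size; fewer than 2^|L| functions have been given up at each stage, since
infinite cardinals absorb their squares.  In the end, every family of sets of
the filter has been refined, so the filter is good.  The constant families show
that each set A is equal to some X b modulo the filter, and A |-> b is the
homomorphism j. *)

Set Implicit Arguments.
Unset Strict Implicit.
Unset Printing Implicit Defensive.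

Import Order.Theory.

Local Open Scope classical_set_scope.

(** * Well-orders and recursion along them *)

Definition wellorder (W : Type) (R : W -> W -> Prop) : Prop :=
  well_founded R /\ forall x y, [\/ R x y, x = y | R y x].

Lemma sval_inj (X : Type) (P : X -> Prop) : injective (@sval X P).
Proof. by move=> [x p] [y q] /= xy; exact: eq_exist. Qed.

Lemma wellorder_exists (W : Type) : exists R : W -> W -> Prop, wellorder R.
Proof.
have [r rwo] := wochoice.well_ordering_principle {classic W}.
have rch : wochoice.wo_chain r predT by move=> A _; exact: rwo.
have rtot x y : r x y || r y x by apply: (wochoice.wo_chainW rch).
exists (fun x y => r x y /\ x <> y); split; last first.
  move=> x y; have [->|nxy] := pselect (x = y); first exact: Or32.
  by have /orP[rxy|ryx] := rtot x y; [apply: Or31|apply: Or33; split=> // /esym].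
move=> x; apply: contrapT => nacc.
pose P : pred W := fun y => ~~ `[< Acc (fun x y => r x y /\ x <> y) y >].
have [|m [[mP mmin] _]] := rwo P; first by exists x; rewrite /in_mem /=; apply/asboolPn.
move: mP; rewrite /in_mem /= => /asboolPn; apply; constructor=> y [rym nym].
apply: contrapT => nay; apply: nym.
have rmy : r m y by apply: mmin; rewrite /in_mem /=; apply/asboolPn.
by apply: (wochoice.wo_chain_antisymmetric rch) => //; apply/andP.
Qed.

(** Well-foundedness excludes cycles of length two and three, and trichotomy leaves
no other alternative to transitivity. *)
Lemma wellorder_trans (W : Type) (R : W -> W -> Prop) : wellorder R ->
  forall x y z, R x y -> R y z -> R x z.
Proof.
move=> [wf tri] x y z xy yz.
have no2 : forall a b, R a b -> R b a -> False.
  by elim/(well_founded_induction wf) => a IH b ab ba; exact: (IH b ba a).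
have no3 : forall a b c, R a b -> R b c -> R c a -> False.
  by elim/(well_founded_induction wf) => a IH b c ab bc ca; exact: (IH c ca a b).
case: (tri x z) => // [xz|zx]; last by case: (no3 x y z).
by case: (no2 x y) => //; rewrite xz.
Qed.

Lemma wellorder_pullback (V W : Type) (R : W -> W -> Prop) (f : V -> W) :
  injective f -> wellorder R -> wellorder (fun x y => R (f x) (f y)).
Proof.
move=> finj [wf tri]; split; first exact: Inverse_Image.wf_inverse_image.
move=> x y; case: (tri (f x) (f y)) => [h|/finj h|h];
  [exact: Or31|exact: Or32|exact: Or33].
Qed.

Definition lex (V W : Type) (R : V -> V -> Prop) (S : W -> W -> Prop) (p q : V * W) :=
  R p.1 q.1 \/ (p.1 = q.1 /\ S p.2 q.2).

Lemma wellorder_lex (V W : Type) (R : V -> V -> Prop) (S : W -> W -> Prop) :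
  wellorder R -> wellorder S -> wellorder (lex R S).
Proof.
move=> [wfR triR] [wfS triS]; split; last first.
  move=> [x1 x2] [y1 y2]; rewrite /lex /=; case: (triR x1 y1) => [h|->|h].
  - by apply: Or31; left.
  - case: (triS x2 y2) => [h|->|h]; [|exact: Or32|].
    + by apply: Or31; right.
    + by apply: Or33; right.
  - by apply: Or33; left.
case=> x y; elim/(well_founded_induction wfR): x y => x IHx y.
elim/(well_founded_induction wfS): y => y IHy.
by constructor=> -[x' y'] [/= h|/= [-> h]]; [exact: IHx|exact: IHy].
Qed.

(** Transfinite recursion in which the value at x is chosen among the s with
[P x g s], provided that one exists.  The existence can then be proved by
induction, from the properties of the earlier values. *)
Lemma wf_choice (W St : Type) (R : W -> W -> Prop) (s0 : St)
    (P : W -> (W -> St) -> St -> Prop) :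
  well_founded R ->
  (forall x g g' s, (forall y, R y x -> g y = g' y) -> P x g s -> P x g' s) ->
  exists g : W -> St, forall x, (exists s, P x g s) -> P x g (g x).
Proof.
move=> wf loc.
pose ext x (r : forall y, R y x -> St) y :=
  if pselect (R y x) is left h then r y h else s0.
pose F x r := if pselect (exists s, P x (ext x r) s) is left h
              then projT1 (cid h) else s0.
pose g := Fix wf (fun=> St) F.
have gE x : g x = F x (fun y _ => g y).
  apply: (Fix_eq wf (fun=> St) F) => y r r' rr'; congr F.
  by apply: functional_extensionality_dep => z;
     apply: functional_extensionality_dep => h.
have extE x y : R y x -> ext x (fun y _ => g y) y = g y.
  by rewrite /ext => xy; case: pselect.
exists g => x [s Ps]; rewrite gE /F; case: pselect => [h|[]]; last first.
  by exists s; apply: loc Ps => y /extE.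
by case: (cid h) => s' /= Ps'; apply: loc Ps' => y /extE.
Qed.

(** * Comparison of cardinals *)

Definition embeds (X Y : Type) : Prop := exists f : X -> Y, injective f.

Lemma embeds_trans (Y X Z : Type) : embeds X Y -> embeds Y Z -> embeds X Z.
Proof. by move=> [f fi] [g gi]; exists (g \o f); exact: inj_comp. Qed.

Lemma embeds_prod (X X' Y Y' : Type) :
  embeds X X' -> embeds Y Y' -> embeds (X * Y) (X' * Y').
Proof.
move=> [f fi] [g gi]; exists (fun p => (f p.1, g p.2)).
by case=> a b [c d] /= [/fi -> /gi ->].
Qed.

Definition small (L Y : Type) (u : set Y) : Prop :=
  exists f : Y -> L, forall y y', u y -> u y' -> f y = f y' -> y = y'.

Lemma card_le_inj (X Y : Type) (A : set X) (y0 : Y) : (A #<= [set: Y])%card -> small Y A.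
Proof.
move=> /card_leP/injfunPex[f _ fi].
exists (fun x => if pselect (A x) is left h then val (f (SigSub (mem_set h))) else y0).
move=> x x' Ax Ax'; case: pselect => // {}Ax; case: pselect => // {}Ax' /val_inj fxx'.
by have := fi _ _ (mem_set I) (mem_set I) fxx' => -[].
Qed.

Lemma embeds_card (X Y : Type) (y0 : Y) :
  ([set: X] #<= [set: Y])%card -> embeds X Y.
Proof. by move=> /(card_le_inj y0)[f fi]; exists f => x y; exact: fi. Qed.

(** Each w is sent to an element of X that is not the image of a smaller one.  This
can only get stuck at a w whose predecessors exhaust X. *)
Lemma embeds_or_seg (W X : Type) (R : W -> W -> Prop) (x0 : X) :
  wellorder R -> embeds W X \/ exists w, embeds X {y | R y w}.
Proof.
move=> [wf tri]; have [|noseg] := pselect (exists w, embeds X {y | R y w}); first by right.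
left; have [|g gP] := @wf_choice W X R x0 (fun w g x => forall y, R y w -> g y <> x) wf.
  by move=> w g g' x gg' H y yw; rewrite -gg' //; exact: H.
have fresh v w : R v w -> g v <> g w.
  apply: gP; apply: contrapT => none; apply: noseg; exists w.
  have /choice[k kP] : forall x, exists z : {v | R v w}, g (sval z) = x.
    move=> x; apply: contrapT => nz; apply: none; exists x => y yw gyx.
    by apply: nz; exists (exist _ y yw).
  by exists k => x x' kx; rewrite -(kP x) kx kP.
exists g => x y gxy; case: (tri x y) => // h; first by case: (fresh _ _ h).
by case: (fresh _ _ h).
Qed.

Lemma embeds_sig (X : Type) (P : X -> Prop) : embeds {x | P x} X.
Proof. by exists sval; exact: sval_inj. Qed.

Lemma embeds_total (X Y : Type) (y0 : Y) : embeds X Y \/ embeds Y X.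
Proof.
have [R Rwo] := wellorder_exists X.
have [|[w h]] := embeds_or_seg y0 Rwo; [by left|right].
exact: embeds_trans h (embeds_sig _).
Qed.

(** The new point takes the place of the first term of a sequence in X, whose terms
are shifted by one. *)
Lemma embeds_option (X : Type) : embeds nat X -> embeds (option X) X.
Proof.
move=> [i ii].
pose f (x : X) := if pselect (exists n, i n = x) is left h then i (projT1 (cid h)).+1 else x.
have fE n : f (i n) = i n.+1.
  rewrite /f; case: pselect => [h|[]]; last by exists n.
  by case: (cid h) => m /= /ii ->.
have fN x : ~ (exists n, i n = x) -> f x = x by rewrite /f; case: pselect.
have f0 x : f x <> i 0%N.
  have [[n <-]|nx] := pselect (exists n, i n = x); first by rewrite fE => /ii.
  by rewrite fN // => x0; apply: nx; exists 0%N.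
have finj : injective f.
  move=> x y; have [[n <-]|nx] := pselect (exists n, i n = x);
    have [[m <-]|ny] := pselect (exists n, i n = y); rewrite ?fE ?fN //.
  - by move=> /ii[->].
  - by move=> xy; case: ny; exists n.+1.
  - by move=> xy; case: nx; exists m.+1.
exists (oapp f (i 0%N)) => -[x|] [y|] //=; first by move=> /finj ->.
- by move/f0.
- by move/esym/f0.
Qed.

Lemma embeds_nat_sqr (X : Type) : embeds nat (X * X) -> embeds nat X.
Proof.
move=> h; apply: contrapT => nX.
have fX : finite_set [set: X].
  by apply: contrapT => /infiniteP/card_leP/injfunPex[f _ fi]; apply: nX;
     exists (fun n => val (f (SigSub (mem_set (I : [set: nat] n))))) => m n /val_inj
       /(fi _ _ (mem_set I) (mem_set I)) [].
have fXX : finite_set [set: X * X] by rewrite -setXTT; exact: finite_setX.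
suff : infinite_set [set: X * X] by [].
apply/infiniteP; case: h => f fi.
have /card_eqPle[_ h] : (f @` [set: nat] #= [set: nat])%card.
  by apply: inj_card_eq => m n _ _; exact: fi.
by apply: card_le_trans h _; exact: card_leT.
Qed.

Lemma embeds_nat_option (X : Type) : embeds nat (option X) -> embeds nat X.
Proof.
move=> [i ii].
(* At most one term is None; the terms up to it are dropped. *)
have [k ik] : exists k, forall n, i (n + k)%N <> None.
  have [[k ik]|no] := pselect (exists k, i k = None); last first.
    by exists 0%N => n in0; apply: no; exists (n + 0)%N.
  exists k.+1 => n; rewrite -ik => /ii /eqP.
  by rewrite addnS eqn_leq leqNgt ltnS leq_addl.
have /choice[f fP] : forall n, exists x, i (n + k)%N = Some x.
  by move=> n; case E : (i (n + k)%N) => [x|]; [exists x|case: (ik n)].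
exists f => m n fmn; apply: (@addIn k); apply: ii.
by rewrite !fP fmn.
Qed.

Definition absorbs_square (X : Type) : Prop := embeds nat X -> embeds (X * X) X.

Lemma absorbs_square_transfer (X Y : Type) :
  embeds X Y -> embeds Y X -> absorbs_square Y -> absorbs_square X.
Proof.
move=> XY YX sY nX; apply: embeds_trans YX.
by apply: embeds_trans (sY (embeds_trans nX XY)); exact: embeds_prod.
Qed.

Lemma closed_segment_embeds (W : Type) (R : W -> W -> Prop) (m : W) :
  embeds {v | R v m \/ v = m} (option {v | R v m}).
Proof.
exists (fun v => if pselect (R (sval v) m) is left h then Some (exist (R^~ m) _ h) else None).
move=> [v vP] [w wP] /=; case: pselect => vm; case: pselect => wm // E; apply: sval_inj => /=.
  by case: E.
by case: vP => // ->; case: wP.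
Qed.

(** In Goedel's order on [W * W], where pairs are compared by their maximum first,
the pairs below p lie in the square of a closed segment.  By [embeds_or_seg],
either [W * W] embeds in W, or W embeds in such a square; in the second case the
hypothesis shows that W is no larger than one of its proper segments, from which
it inherits the property. *)
Lemma absorbs_square_step (W : Type) (R : W -> W -> Prop) : wellorder R ->
  (forall w, absorbs_square {v | R v w}) -> absorbs_square W.
Proof.
move=> Rwo segs infW; have [i _] := infW.
pose mx (p : W * W) := if pselect (R p.1 p.2) then p.2 else p.1.
have mxP p : (R p.1 (mx p) \/ p.1 = mx p) /\ (R p.2 (mx p) \/ p.2 = mx p).
  rewrite /mx; case: pselect => h /=; first by split; [left|right].
  split; first by right.
  by case: (Rwo.2 p.1 p.2) => // [->|]; [right|left].
have R2wo := wellorder_pullback (f := fun p => (mx p, p)) (fun p q pq => congr1 snd pq)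
  (wellorder_lex Rwo (wellorder_lex Rwo Rwo)).
have [//|[p Wseg]] := embeds_or_seg (i 0%N) R2wo.
pose S : Type := {v | R v (mx p)}.
have WS : embeds W (option S * option S).
  apply: embeds_trans Wseg _.
  apply: (@embeds_trans ({v | R v (mx p) \/ v = mx p} * {v | R v (mx p) \/ v = mx p}));
    last by apply: embeds_prod; exact: closed_segment_embeds.
  have below q v : lex R (lex R R) (mx q, q) (mx p, p) -> R v (mx q) \/ v = mx q ->
      R v (mx p) \/ v = mx p.
    case=> /= [qp|[-> _] //] [vq|->]; left=> //.
    exact: wellorder_trans Rwo _ _ _ vq qp.
  exists (fun q => (exist _ _ (below _ _ (svalP q) (mxP (sval q)).1),
                    exist _ _ (below _ _ (svalP q) (mxP (sval q)).2))).
  by move=> [[q1 q2] qP] [[r1 r2] rP] /= [q1r1 q2r2]; apply: sval_inj; rewrite /= q1r1 q2r2.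
have infS : embeds nat S.
  by apply/embeds_nat_option/embeds_nat_sqr; exact: embeds_trans infW WS.
have SW : embeds W S.
  apply: embeds_trans WS _; apply: embeds_trans (segs (mx p) infS).
  by apply: embeds_prod; exact: embeds_option.
apply: (absorbs_square_transfer SW (embeds_sig _)) => //; exact: segs.
Qed.

Theorem infinite_absorbs_square (X : Type) : absorbs_square X.
Proof.
have [R Rwo] := wellorder_exists X.
apply: (absorbs_square_step Rwo).
elim/(well_founded_induction Rwo.1) => w IH.
pose R' (u v : {v | R v w}) := R (sval u) (sval v).
have R'wo : wellorder R'.
  exact: wellorder_pullback (@sval_inj _ _) Rwo.
apply: (absorbs_square_step R'wo) => u.
apply: absorbs_square_transfer (IH (sval u) (svalP u)).
  exists (fun v : {v | R' v u} => exist (R^~ (sval u)) (sval (sval v)) (svalP v)).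
  by move=> v v' [vv']; apply/sval_inj/sval_inj.
exists (fun v : {v | R v (sval u)} => exist (R'^~ u)
  (exist (R^~ w) (sval v) (wellorder_trans Rwo (svalP v) (svalP u))) (svalP v)).
by move=> v v' [vv']; apply: sval_inj.
Qed.

(** Iterated pairing is injective on the sequences of a given size. *)
Lemma embeds_seq (X : Type) : embeds nat X -> embeds (seq X) X.
Proof.
move=> infX; have [i ii] := infX; have [c ci] := infinite_absorbs_square infX.
pose enc := foldr (fun x y => c (x, y)) (i 0%N).
have encI s t : size s = size t -> enc s = enc t -> s = t.
  elim: s t => [|x s IH] [|y t] //= [st] /ci[-> /IH ->] //.
exists (fun s => c (i (size s), enc s)) => s t /ci[/ii]; exact: encI.
Qed.

Lemma embeds_fset (L : choiceType) : embeds nat L -> embeds {fset L} L.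
Proof.
move=> /embeds_seq; apply: embeds_trans.
by exists (fun s : {fset L} => enum_fset s) => s t; exact: val_inj.
Qed.

Lemma not_embeds_set (X : Type) : ~ embeds (set X) X.
Proof.
move=> [f fi]; pose D := [set x | exists2 A, f A = x & ~ A x].
have nD : ~ D (f D) by move=> /[dup] DD [A /fi ->].
by apply: (nD); exists D.
Qed.

(** A well-order of X, cut at the least point whose predecessors are as many as X, if
there is one. *)
Lemma initial_wellorder (X : Type) : exists (W : Type) (R : W -> W -> Prop),
  [/\ wellorder R, embeds X W & forall w, ~ embeds X {v | R v w}].
Proof.
have [R Rwo] := wellorder_exists X.
have [[w Xw]|no] := pselect (exists w, embeds X {v | R v w}); last first.
  by exists X, R; split=> // [|w h]; [exists id|apply: no; exists w].
elim/(well_founded_induction Rwo.1): w Xw => w IH Xw.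
have [[v vw Xv]|no] := pselect (exists2 v, R v w & embeds X {u | R u v}).
  exact: IH vw Xv.
exists {v | R v w}, (fun u v => R (sval u) (sval v)); split; [|exact: Xw|move=> v Xv].
  exact: wellorder_pullback (@sval_inj _ _) Rwo.
apply: no; exists (sval v); first exact: (svalP v).
apply: embeds_trans Xv _.
exists (fun u : {u : {v | R v w} | R (sval u) (sval v)} =>
  exist (R^~ (sval v)) (sval (sval u)) (svalP u)).
by move=> u u' [uu']; apply/sval_inj/sval_inj.
Qed.

Lemma small_product (X Y L : Type) : embeds nat L -> ~ embeds X L -> ~ embeds X Y ->
  ~ embeds X (Y * L).
Proof.
move=> infL XL XY XYL; have [l _] := infL.
have idem Z : embeds Z Z by exists id.
have [YL|LY] := embeds_total Y (l 0%N).
  apply: XL; apply: embeds_trans XYL _; apply: embeds_trans (infinite_absorbs_square infL).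
  exact: embeds_prod.
apply: XY; apply: embeds_trans XYL _.
apply: embeds_trans (infinite_absorbs_square (embeds_trans infL LY)).
exact: embeds_prod.
Qed.

(** * Good filters are excellent *)

Section Excellence.
Local Open Scope fset_scope.

(** For antitone f, a multiplicative refinement of f: the set at v is contained in
f v, and the sets at u and at v meet in the set at their union. *)
Definition refinement (I : Type) (L : choiceType) (f : {fset L} -> set I)
    (w : I -> {fset L}) (v : {fset L}) : set I :=
  [set t | v `<=` w t /\ f (w t) t].

(** On regular filters this is Keisler's goodness: an arbitrary f reduces to the
antitone one which maps v to the intersection of the f u, u <= v, and regularity
makes the values of w finite. *)
Definition good (I : Type) (L : choiceType) (D : set_system I) : Prop :=
  forall f : {fset L} -> set I, (forall v, D (f v)) ->
  exists w : I -> {fset L}, forall v, D (refinement f w v).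

Fixpoint bholds (V : Type) (p : V -> Prop) (s : bterm V) : Prop :=
  match s with
  | BVar v => p v
  | BBot => False
  | BTop => True
  | BMeet s1 s2 => bholds p s1 /\ bholds p s2
  | BJoin s1 s2 => bholds p s1 \/ bholds p s2
  | BCompl s1 => ~ bholds p s1
  end.

Lemma beval_setE (I V : Type) (a : V -> set I) (s : bterm V) (t : I) :
  beval a s t = bholds (fun v => a v t) s.
Proof.
by elim: s => //= [s1 <- s2 <-|s1 <- s2 <-|s1 <-].
Qed.

Lemma beval_modclass (I V : Type) (D : pfilter_on I) (a : V -> set I) (s : bterm V) :
  beval (fun v => modclass D (a v)) s = modclass D (beval a s).
Proof.
elim: s => //= [s1 -> s2 ->|s1 -> s2 ->|s1 ->].
- exact: qmeetE.
- exact: qjoinE.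
- exact: qcomplE.
Qed.

Lemma beval_modclass0 (I V : Type) (D : pfilter_on I) (a : V -> set I) (s : bterm V) :
  beval (fun v => modclass D (a v)) s = \bot%O -> D (~` beval a s).
Proof.
rewrite beval_modclass => /eqP/modclassP; apply: filterS => t /= h /h.
by [].
Qed.

Section Pattern.
Variables (I : Type) (L : choiceType) (D : pfilter_on I) (A : {fset L} -> set I).

Definition same_pattern (u : {fset L}) (t : I) : set I :=
  [set t' | forall v, v `<=` u -> A v t' = A v t].

Definition typical (u : {fset L}) : set I := [set t | ~ D (~` same_pattern u t)].

(** There are finitely many patterns over u, and a point that is not typical has one
of those which occur on a null set only. *)
Lemma typical_large (u : {fset L}) : D (typical u).
Proof.
pose pat t := [ffun v : fpowerset u => `[< A (val v) t >]].
have patP t t' : pat t' = pat t -> same_pattern u t t'.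
  move=> /ffunP tt' v; rewrite -fpowersetE => vu.
  have := tt' [` vu]; rewrite !ffunE /= => E.
  by apply/propext; split=> /asboolP; [rewrite E|rewrite -E] => /asboolP.
have : D [set t | forall q, D [set t' | pat t' <> q] -> pat t <> q].
  apply: filter_forall => q.
  have [Dq|nDq] := pselect (D [set t' | pat t' <> q]).
    by apply: filterS Dq => t tq.
  by apply: filterE => t /nDq.
apply: filterS => t h Dn; apply: (h (pat t)) => //.
by apply: filterS Dn => t' ns E; apply: ns; exact: patP.
Qed.

End Pattern.

(** With [B v] the part of [A v] in the refinement of the typical sets, the sets
[B v], v <= u, have at t either the pattern 0, or the pattern of the truncation of
A to the subsets of [u `&` w t].  The latter occurs on a positive set, since t is
typical for [w t].  A term in Lambda vanishes on almost all points for both of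
these sequences, hence at t. *)
Lemma good_excellent (I : Type) (L : choiceType) (D : pfilter_on I) :
  good L D -> excellent L D.
Proof.
move=> Dgood A.
have [w wD] := Dgood _ (typical_large D A).
exists (fun v => A v `&` refinement (typical D A) w v)%classic => u.
split; first by move=> t [].
  by apply: modclassE; apply: filterS (wD u) => t ? /=; split=> [[]|].
move=> s sL; apply/seteqP; split=> // t; rewrite beval_setE => st.
have [typ|ntyp] := pselect (typical D A (w t) t).
  pose A' (v : fpowerset u) := if val v `<=` u `&` w t then A (val v) else set0.
  have : D (~` beval A' s).
    apply: beval_modclass0; apply: sL; left; exists (u `&` w t); first exact: fsubsetIl.
    by apply/funext => v; rewrite /truncation /A'; case: ifP.
  move=> nA'; apply: (typ); apply: filterS nA' => t' nA' same; apply: nA'.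
  rewrite beval_setE; congr bholds: st; apply/funext => v; rewrite /A'.
  have vu : val v `<=` u by rewrite -fpowersetE; exact: valP.
  rewrite fsubsetI vu /=; case: ifP => vw; apply/propext.
    by rewrite (same _ vw); split=> [[]//|Av]; split=> //; exact: (conj vw typ).
  by split=> [[_ []]|] //; rewrite vw.
have : D (~` beval (fun _ : fpowerset u => set0) s).
  by apply: beval_modclass0; apply: sL; right.
move=> /filter_ex[t']; rewrite /= beval_setE; apply.
congr bholds: st; apply/funext => v; apply/propext; split=> // -[_ [vw typ]].
exact: ntyp.
Qed.

End Excellence.

Notation eqm D A A' := (D [set t | A t <-> A' t]).

(** * One stage of the construction *)

Section Stages.
Variables (d : Order.disp_t) (B : ctbDistrLatticeType d).
Variables (L G : choiceType) (I : Type).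
Variables (g : G -> I -> {fset L}) (X : B -> set I).
Implicit Types (D : set_system I) (U : set G) (b c : B) (e : seq G) (h : G -> {fset L}).

(** X induces a homomorphism from B to the quotient by D. *)
Definition represents D : Prop :=
  (forall b c, eqm D (X (Order.meet b c)) (X b `&` X c)) /\
  (forall b, eqm D (X (Order.compl b)) (~` X b)).

(** Conditions prescribe a value in B and finitely many values of the functions g Z.
Taking h total and e apart makes the union of conditions easy to write. *)
Definition condition b e h : set I := [set t | X b t /\ forall Z, Z \in e -> g Z t = h Z].

Definition avoids U e : Prop := forall Z, Z \in e -> ~ U Z.

(** U is the set of functions that have been given up; the others are independent of
D and of the X b. *)
Definition independent D U : Prop :=
  forall b e h A, b <> \bot%O -> avoids U e -> D A -> condition b e h `&` A !=set0.

Lemma represents_le D b c : Filter D -> represents D -> (b <= c)%O ->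
  D [set t | X b t -> X c t].
Proof.
by move=> FD [rI _] /meet_l bc; apply: filterS (rI b c) => t; rewrite bc => -[h _] /h[].
Qed.

Lemma represents0 D : Filter D -> represents D -> D [set t | ~ X \bot%O t].
Proof.
move=> FD [rI rC]; apply: filterS (filterI (rI \top%O \bot%O) (rC \top%O)) => t.
by rewrite meetx0 compl1 => -[/= [h _] [h' _]] Xt; case: (h Xt) => ? _; exact: h'.
Qed.

(** An element is coded by a c and its position in [e c]. *)
Lemma small_seq_union (C : set B) (e : B -> seq G) : embeds nat L -> small L C ->
  small L [set Z | exists2 c, C c & Z \in e c].
Proof.
move=> infL [f finj]; have [i ii] := infL; have [p pinj] := infinite_absorbs_square infL.
have /choice[k kP] : forall Z, exists c, (exists2 c, C c & Z \in e c) -> C c /\ Z \in e c.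
  move=> Z; have [[c Cc Zc]|no] := pselect (exists2 c, C c & Z \in e c); first by exists c.
  by exists \bot%O => h; case: no.
exists (fun Z => p (f (k Z), i (index Z (e (k Z))))) => Z Z' /kP[CZ Ze] /kP[CZ' Ze'].
move=> /pinj[/finj kk /ii]; rewrite -kk // in Ze' *; move=> idx.
by rewrite -(nth_index Z Ze) idx nth_index.
Qed.

(** Let b be the supremum of the elements c which force A, that is, for which some
condition (c, e, h) is contained in A modulo D; then A may be declared equal to
X b.  For a condition (c, e, h) on the unused functions, if c is disjoint from b,
then c does not force A, and there are points outside A and outside X b.  If c meets
b, it meets a member c' of a maximal antichain C of forcing elements, since C has
supremum b as well.  The functions by which the members of C force A are given up,
so that the condition of c' is compatible with (c, e, h); a common point is in A and
in X b. *)
Lemma decide_step D U (A : set I) : embeds nat L -> complete_ba B ->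
  (forall S : set B, antichain S -> small L S) ->
  Filter D -> represents D -> independent D U ->
  exists (D' : set_system I) (u : set G) b,
    [/\ Filter D', D `<=` D', small L u, independent D' (U `|` u) & eqm D' A (X b)] /\
    (forall c e h F, c <> \bot%O -> avoids U e -> D F -> condition c e h `&` F `<=` A ->
      (c <= b)%O).
Proof.
move=> infL Bcomp Bcc FD rD indD.
pose forced c e h F := [/\ avoids U e, D F & condition c e h `&` F `<=` A].
pose E := [set c | c <> \bot%O /\ exists e h F, forced c e h F].
have [C [CE tC maxC]] :=
  ex_maximal_disjoint_subcollection (fun c => [set x : B | x <> \bot%O /\ (x <= c)%O]) E.
have aC : antichain C.
  split=> [x /CE[] //|x y Cx Cy xy]; apply: contrapT => nxy; apply: xy.
  by apply: tC => //; exists (Order.meet x y); split; split=> //; rewrite ?leIl ?leIr.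
have [[b [bub blub]] _] := Bcomp C.
(* Otherwise the part of c outside b could be added to C. *)
have Eb c : E c -> (c <= b)%O.
  move=> [c0 [e [h [F [off DF sub]]]]]; apply: contrapT => ncb.
  pose c' := Order.meet c (Order.compl b).
  have c'0 : c' <> \bot%O by move/eqP; rewrite disj_leC complK => /ncb.
  have nCc' : ~ C c'.
    move=> /bub c'b; apply: c'0; apply/eqP; rewrite -lex0 -(meetxC b) lexI c'b.
    exact: leIr.
  apply: (maxC (C `|` [set c'])).
  - by split=> [x ? | /(_ c' (or_intror erefl)) //]; left.
  - move=> x [/CE //|->]; split=> //; exists e, h, (F `&` [set t | X c' t -> X c t]).
    split=> //; first by apply: filterI => //; apply: represents_le => //; exact: leIl.
    by move=> t [[Xc' gh] [Ft Xcc]]; apply: sub; split=> //; split=> //; exact: Xcc.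
  - have dis x : C x -> [set x0 | x0 <> \bot%O /\ (x0 <= x)%O] `&`
        [set x | x <> \bot%O /\ (x <= c')%O] !=set0 -> False.
      move=> /bub xb [y [[y0 yx] [_ yc']]]; apply: y0; apply/eqP; rewrite -lex0 -(meetxC b) lexI.
      by rewrite (le_trans yx xb) (le_trans yc') // leIr.
    move=> x y [Cx|->] [Cy|->] //; first exact: tC.
      by move/(dis _ Cx).
    by rewrite setIC => /(dis _ Cy).
(* The condition and the set of D by which each member of C forces A. *)
have /choice[k kP] : forall c, exists r : seq G * (G -> {fset L}) * set I,
    C c -> forced c r.1.1 r.1.2 r.2.
  move=> c; have [/CE[_ [e [h [F H]]]]|nC] := pselect (C c); first by exists (e, h, F).
  by exists ([::], fun=> fset0, setT) => /nC.
pose u := [set Z | exists2 c, C c & Z \in (k c).1.1].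
pose D' := [set Y | exists2 F, D F & F `&` [set t | A t <-> X b t] `<=` Y].
have DD' : D `<=` D' by move=> Y DY; exists Y => // t [].
have FD' : Filter D'.
  split; first by apply: DD'; exact: filterT.
    move=> Y Y' [F DF FY] [F' DF' FY']; exists (F `&` F'); first exact: filterI.
    by move=> t [[Ft F't] ?]; split; [apply: FY|apply: FY'].
  by move=> Y Y' YY' [F DF FY]; exists F => // t /FY/YY'.
exists D', u, b; split; last first.
  by move=> c e h F c0 off DF sub; apply: Eb; split=> //; exists e, h, F.
split=> //; first by apply: small_seq_union => //; exact: Bcc.
  move=> c e h Y c0 off [F DF FY].
  have [cb|cb] := pselect (Order.meet c b = \bot%O).
    apply: contrapT => none.
    have cEb : (c <= b)%O.
      apply: Eb; split=> //; exists e, h,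
        (F `&` ([set t | X (Order.meet c b) t <-> (X c `&` X b) t] `&` [set t | ~ X \bot%O t])).
      split; first by move=> Z Ze; move: (off Z Ze); apply: contra_not; left.
        by apply: filterI => //; apply: filterI; [exact: rD.1|exact: represents0].
      move=> t [ct [Ft [/= tI t0]]]; apply: contrapT => nAt.
      apply: none; exists t; split=> //; apply: FY; split=> //=; split=> // Xbt.
      by case: t0; rewrite -cb; apply/tI; split=> //; exact: ct.1.
    by apply: c0; rewrite -cb; apply/esym/meet_l.
  have [c' Cc' cc'] : exists2 c', C c' & Order.meet c c' <> \bot%O.
    apply: contrapT => none; apply: cb; apply/eqP; rewrite meetC disj_leC; apply: blub.
    move=> x Cx; rewrite -disj_leC meetC; apply/eqP; apply: contrapT => cx.
    by apply: none; exists x.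
  have [off' DF' sub'] := kP c' Cc'.
  pose h' Z := if Z \in (k c').1.1 then (k c').1.2 Z else h Z.
  have [t [[Xt gt] [Ft [F't [/= tI tb]]]]] :
      condition (Order.meet c c') (e ++ (k c').1.1) h' `&` (F `&` ((k c').2 `&`
        ([set t | X (Order.meet c c') t <-> (X c `&` X c') t] `&` [set t | X c' t -> X b t])))
      !=set0.
    apply: indD => //.
      by move=> Z; rewrite mem_cat => /orP[/off|/off'] //; apply: contra_not; left.
    apply: filterI => //; apply: filterI => //; apply: filterI; first exact: rD.1.
    by apply: represents_le => //; exact: bub.
  have [Xct Xc't] := tI.1 Xt.
  exists t; split.
    split=> // Z Ze; rewrite gt ?mem_cat ?Ze // /h'; case: ifP => // Zk.
    by case: (off Z Ze); right; exists c'.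
  apply: FY; split=> //=; split=> _; first exact: tb.
  apply: sub'; split=> //; split=> // Z Zk; rewrite gt ?mem_cat ?Zk ?orbT //.
  by rewrite /h' Zk.
by exists setT; [exact: filterT|move=> t []].
Qed.

(** The second case keeps f v out of all later filters: their sets still meet
X c, for c the nonzero complement of b. *)
Definition handled D (f : {fset L} -> set I) : Prop :=
  (exists w, forall v, D (refinement f w v)) \/
  (exists v b, b <> \top%O /\ eqm D (f v) (X b)).

(** If no condition on the unused functions excludes f v modulo D, for any v, then the
unused function g Z0 may be taken for w: below each condition that leaves g Z0 free,
g Z0 can be given the value v at a point of f v, which is then a point of the
refinement at v.  Otherwise the complement of such an f v is decided. *)
Lemma stage D U (Z0 : G) (f : {fset L} -> set I) : embeds nat L -> complete_ba B ->
  (forall S : set B, antichain S -> small L S) ->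
  Filter D -> represents D -> independent D U -> ~ U Z0 ->
  exists (D' : set_system I) (u : set G),
    [/\ Filter D', D `<=` D', small L u, independent D' (U `|` u) & handled D' f].
Proof.
move=> infL Bcomp Bcc FD rD indD nU.
have [[c [e [h [F [v [c0 off DF sub]]]]]]|consistent] := pselect (exists c e h F v,
    [/\ c <> \bot%O, avoids U e, D F & condition c e h `&` F `<=` ~` f v]).
  have [D' [u [b [[FD' DD' su indD' Ab] max]]]] :=
    decide_step (~` f v) infL Bcomp Bcc FD rD indD.
  exists D', u; split=> //; right; exists v, (Order.compl b); split.
    move/(congr1 (@Order.compl _ _)); rewrite complK compl1 => b0; apply: (c0).
    by apply/eqP; rewrite -lex0 -b0; exact: (max c e h F).
  apply: filterS (filterI Ab (DD' _ (rD.2 b))) => t /= [[h1 h2] [h3 h4]]; split=> [ft|Xt].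
    by apply: h4 => /h2.
  by apply: contrapT => /h1; exact: h3.
pose D' := [set Y | exists F v, D F /\ F `&` refinement f (g Z0) v `<=` Y].
have DD' : D `<=` D' by move=> Y DY; exists Y, fset0; split=> // t [].
exists D', [set Z0]; split=> //.
- split; first by apply: DD'; exact: filterT.
    move=> Y Y' [F [v [DF FY]]] [F' [v' [DF' FY']]]; exists (F `&` F'), (v `|` v')%fset.
    split; first exact: filterI.
    move=> t [[Ft F't] [/=]]; rewrite fsubUset => /andP[vt v't] ft.
    by split; [apply: FY|apply: FY'].
  by move=> Y Y' YY' [F [v [DF FY]]]; exists F, v; split=> // t /FY/YY'.
- by have [i _] := infL; exists (fun=> i 0%N) => Z Z' -> ->.
- move=> b e h Y b0 off [F [v [DF FY]]].
  have nZ0 Z : Z \in e -> Z != Z0 by move=> /off nZ; apply/eqP => ?; apply: nZ; right.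
  pose h' Z := if Z == Z0 then v else h Z.
  have : ~ (condition b (Z0 :: e) h' `&` F `<=` ~` f v).
    move=> sub; apply: consistent; exists b, (Z0 :: e), h', F, v; split=> //.
    by move=> Z; rewrite in_cons => /predU1P[->|/off] //; apply: contra_not; left.
  move=> /existsNP[t /not_implyP[[[Xt gt] Ft] /contrapT ft]].
  have gZ0 : g Z0 t = v by rewrite gt ?mem_head // /h' eqxx.
  exists t; split; last by apply: FY; split=> //; split=> /=; rewrite gZ0.
  by split=> // Z Ze; rewrite gt ?in_cons ?Ze ?orbT // /h' (negPf (nZ0 _ Ze)).
- by left; exists (g Z0) => v; exists setT, v; split=> [|t []] //; exact: filterT.
Qed.

End Stages.

(** * The transfinite construction *)

Lemma filter_directed (I W : Type) (D0 : set_system I) (F : W -> set_system I) (P : W -> Prop) :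
  Filter D0 -> (forall w, P w -> Filter (F w) /\ D0 `<=` F w) ->
  (forall v w, P v -> P w -> F v `<=` F w \/ F w `<=` F v) ->
  Filter [set A | D0 A \/ exists2 w, P w & F w A].
Proof.
move=> F0 FP tot; split; first by left; exact: filterT.
  move=> A A' [DA|[w Pw wA]] [DA'|[v Pv vA']].
  - by left; exact: filterI.
  - by right; exists v => //; have [? s] := FP v Pv; apply: filterI => //; exact: s.
  - by right; exists w => //; have [? s] := FP w Pw; apply: filterI => //; exact: s.
  - right; have [vw|wv] := tot v w Pv Pw.
      by exists w => //; have [? _] := FP w Pw; apply: filterI => //; exact: vw.
    by exists v => //; have [? _] := FP v Pv; apply: filterI => //; exact: wv.
move=> A A' AA' [DA|[w Pw wA]]; first by left; exact: filterS DA.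
by right; exists w => //; have [? _] := FP w Pw; exact: filterS wA.
Qed.

Section Induction.
Variables (d : Order.disp_t) (B : ctbDistrLatticeType d).
Variables (L G : choiceType) (I : Type).
Variables (g : G -> I -> {fset L}) (X : B -> set I).
Variables (W : Type) (R : W -> W -> Prop) (task : W -> {fset L} -> set I).

(** The state at w consists of the filter after stage w and of the functions given up
at that stage.  Stage w starts with the union of the earlier filters; independence
passes to the union because each of its sets already belongs to an earlier stage,
where no more functions had been given up. *)
Lemma handle_all (D0 : set_system I) :
  embeds nat L -> complete_ba B -> (forall S : set B, antichain S -> small L S) ->
  wellorder R ->
  (forall w (u : W -> set G), (forall v, R v w -> small L (u v)) ->
    exists Z, forall v, R v w -> ~ u v Z) ->
  Filter D0 -> represents X D0 -> independent g X D0 set0 ->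
  exists D, [/\ Filter D, D0 `<=` D, forall b A, b <> \bot%O -> D A -> X b `&` A !=set0 &
    forall w, handled X D (task w)].
Proof.
move=> infL Bcomp Bcc Rwo room F0 rep0 ind0.
pose below (st : W -> set_system I * set G) w : set_system I :=
  [set A | D0 A \/ exists2 v, R v w & (st v).1 A].
pose used (st : W -> set_system I * set G) w : set G :=
  [set Z | exists2 v, R v w & (st v).2 Z].
pose P w st (s : set_system I * set G) :=
  [/\ Filter s.1, below st w `<=` s.1, small L s.2,
      independent g X s.1 (used st w `|` s.2) & handled X s.1 (task w)].
have [|st stP] := @wf_choice W _ R (D0, set0) P Rwo.1.
  move=> w st st' s ss; rewrite /P.
  have -> : below st w = below st' w.
    by apply/seteqP; split=> A [?|[v vw]]; [left|rewrite ss //; right; exists v|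
      left|rewrite -ss //; right; exists v].
  by have -> : used st w = used st' w by apply/seteqP; split=> Z [v vw];
    [rewrite ss //|rewrite -ss //]; exists v.
have inc v w : P w st (st w) -> R v w -> (st v).1 `<=` (st w).1.
  by move=> [_ bw _ _ _] vw A vA; apply: bw; right; exists v.
have {}stP w : P w st (st w).
  elim/(well_founded_induction Rwo.1): w => w IH; apply: stP.
  have Fb : Filter (below st w).
    apply: filter_directed => // [v /IH[Fv bv _ _ _]|v v' vw v'w].
      by split=> // A DA; apply: bv; left.
    case: (Rwo.2 v v') => [vv'|->|v'v]; [left|left|right] => //.
      exact: inc (IH _ v'w) vv'.
    exact: inc (IH _ vw) v'v.
  have repb : represents X (below st w) by split=> [b c|b]; left; [exact: rep0.1|exact: rep0.2].
  have indb : independent g X (below st w) (used st w).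
    move=> b e h A b0 off [DA|[v vw vA]]; first by apply: ind0 => // Z _ [].
    have [_ _ _ indv _] := IH v vw; apply: indv => // Z /off nZ [[v' v'v uZ]|uZ]; apply: nZ.
      by exists v' => //; exact: (wellorder_trans Rwo v'v vw).
    by exists v.
  have [|Z Zfree] := room w (fun v => (st v).2); first by move=> v /IH[].
  have nZ : ~ used st w Z by move=> [v /Zfree].
  have [D' [u [? ? ? ? ?]]] := stage (task w) infL Bcomp Bcc Fb repb indb nZ.
  by exists (D', u).
exists [set A | D0 A \/ exists2 w, True & (st w).1 A]; split.
- apply: filter_directed => // [w _|v w _ _].
    by have [Fw bw _ _ _] := stP w; split=> // A DA; apply: bw; left.
  by case: (Rwo.2 v w) => [vw|->|wv]; [left|left|right] => //; exact: inc.
- by move=> A; left.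
- move=> b A b0 DA.
  have [t [[Xt _] At]] : condition g X b [::] (fun=> fset0) `&` A !=set0.
    by case: DA => [DA|[w _ wA]]; [exact: ind0|have [_ _ _ indw _] := stP w; exact: indw].
  by exists t.
- move=> w; have [_ _ _ _ [[r rD]|[v [b [b1 vb]]]]] := stP w; [left|right].
    by exists r => v; right; exists w.
  by exists v, b; split=> //; right; exists w.
Qed.

End Induction.

(** * An independent family of functions over a representation of B *)

Section Base.
Local Open Scope fset_scope.
Variable (L : choiceType).
Implicit Types (Z : set L) (s k : {fset L}).

Definition trace Z s : {fset L} := [fset x in s | `[< Z x >]].

Lemma in_trace Z s x : (x \in trace Z s) = (x \in s) && `[< Z x >].
Proof. by rewrite !inE. Qed.

(** Finitely many sets are already distinguished by their traces on a finite set. *)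
Lemma traces_separate (E : seq (set L)) : exists s0, forall s, s0 `<=` s ->
  forall Z Z', Z \in E -> Z' \in E -> trace Z s = trace Z' s -> Z = Z'.
Proof.
have pair Z Z' : exists s0, forall s, s0 `<=` s -> trace Z s = trace Z' s -> Z = Z'.
  have [[x xZ]|same] := pselect (exists x, ~ (Z x <-> Z' x)); last first.
    exists fset0 => s _ _; apply/funext => x; apply/propext.
    by apply: contrapT => xZ; apply: same; exists x.
  exists [fset x] => s; rewrite fsub1set => xs ZZ'; case: xZ.
  have : (x \in trace Z s) = (x \in trace Z' s) by rewrite ZZ'.
  by rewrite !in_trace xs /= => e; rewrite -[Z x]asboolE e asboolE.
have pairs (P : seq (set L * set L)) : exists s0, forall s, s0 `<=` s ->
    forall p, p \in P -> trace p.1 s = trace p.2 s -> p.1 = p.2.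
  elim: P => [|p P [s1 s1P]]; first by exists fset0.
  have [s0 s0P] := pair p.1 p.2; exists (s0 `|` s1) => s; rewrite fsubUset => /andP[ss0 ss1].
  by move=> q; rewrite in_cons => /predU1P[->|]; [exact: s0P|exact: s1P].
have [s0 s0P] := pairs [seq (Z, Z') | Z <- E, Z' <- E].
by exists s0 => s ss Z Z' ZE Z'E; apply: (s0P s ss (Z, Z')); exact: allpairs_f.
Qed.

Fixpoint lookup (l : seq ({fset L} * {fset L})) k : {fset L} :=
  if l is (k', v) :: l' then if k' == k then v else lookup l' k else fset0.

Lemma lookup_map (G : eqType) (key val : G -> {fset L}) (e : seq G) (Z : G) :
  {in e &, injective key} -> Z \in e -> lookup [seq (key Y, val Y) | Y <- e] (key Z) = val Z.
Proof.
elim: e => //= Y e IH inj; rewrite in_cons => Ze.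
case: eqP => [kk|nk]; first by rewrite (inj Y Z) ?mem_head ?in_cons.
apply: IH; first by move=> x y xe ye; apply: inj; rewrite in_cons ?xe ?ye orbT.
by case/predU1P: Ze => // ZY; case: nk; rewrite ZY.
Qed.

(** A point (s, l, m) is a finite approximation to a function and to an ultrafilter:
l is a table of values for traces on s, and m lists the traces on s of the codes of
the elements of B that are taken to be in the ultrafilter. *)
Definition point : Type := {fset L} * seq ({fset L} * {fset L}) * seq {fset L}.

Lemma embeds_point : embeds nat L -> embeds point L.
Proof.
move=> infL; have LL := infinite_absorbs_square infL.
have K := embeds_fset infL; have S := embeds_seq infL.
have map_seq (Y : Type) : embeds Y L -> embeds (seq Y) L.
  move=> [f fi]; apply: embeds_trans S; exists (map f); exact: inj_map.
have KK : embeds ({fset L} * {fset L}) L by apply: embeds_trans (LL); exact: embeds_prod.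
apply: embeds_trans (LL); apply: embeds_prod; last exact: map_seq.
by apply: embeds_trans (LL); apply: embeds_prod => //; exact: map_seq.
Qed.

Variables (d : Order.disp_t) (B : ctbDistrLatticeType d) (z : B -> set L).
Hypothesis zinj : injective z.
Variables (I : Type) (pt : I -> point).
Hypothesis pt_surj : forall p, exists t, pt t = p.

(** Hausdorff's independent family, with one function for each subset of L. *)
Definition value Z (t : I) : {fset L} := lookup (pt t).1.2 (trace Z (pt t).1.1).

Definition member (b : B) : set I := [set t | trace (z b) (pt t).1.1 \in (pt t).2].

Definition agrees (a : B) (t : I) (c : B) : Prop :=
  (member c t /\ (a <= c)%O) \/ (~ member c t /\ (a <= Order.compl c)%O).

(** The base filter requires s to be large and the approximate ultrafilter to
look like a true one on finitely many elements C: a nonzero a which decides all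
elements of C stands for an ultrafilter that contains a. *)
Definition base : set_system I := [set A | exists s0 (C : seq B), forall t,
  s0 `<=` (pt t).1.1 -> (exists2 a, a <> \bot%O & forall c, c \in C -> agrees a t c) -> A t].

Lemma base_filter : Filter base.
Proof.
split; first by exists fset0, [::].
  move=> A A' [s [C AP]] [s' [C' AP']]; exists (s `|` s'), (C ++ C') => t.
  rewrite fsubUset => /andP[st s't] [a a0 aC]; split.
    by apply: AP => //; exists a => // c cC; apply: aC; rewrite mem_cat cC.
  by apply: AP' => //; exists a => // c cC; apply: aC; rewrite mem_cat cC orbT.
by move=> A A' AA' [s [C AP]]; exists s, C => t st at_; apply: AA'; exact: AP.
Qed.

Lemma agrees_le (a c : B) t : a <> \bot%O -> agrees a t c ->
  (member c t <-> (a <= c)%O) /\ (~ member c t <-> (a <= Order.compl c)%O).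
Proof.
move=> a0 ac.
have clash : (a <= c)%O -> (a <= Order.compl c)%O -> False.
  by move=> u v; apply: a0; apply/eqP; rewrite -lex0 -(meetxC c) lexI u.
by case: ac => -[m u]; split; split=> // v; case: clash.
Qed.

Lemma base_represents : represents member base.
Proof.
split=> [b c|b].
  exists fset0, [:: b; c; Order.meet b c] => t _ [a a0 aC].
  have [bC cC mC] : [/\ b \in [:: b; c; Order.meet b c], c \in [:: b; c; Order.meet b c]
      & Order.meet b c \in [:: b; c; Order.meet b c]] by rewrite !inE !eqxx !orbT.
  have [mb _] := agrees_le a0 (aC _ bC); have [mc _] := agrees_le a0 (aC _ cC).
  have [mm _] := agrees_le a0 (aC _ mC).
  by rewrite /setI /= mb mc mm lexI; split=> /andP.
exists fset0, [:: b; Order.compl b] => t _ [a a0 aC].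
have [_ mb] := agrees_le a0 (aC b (mem_head _ _)).
have [m _] := agrees_le a0 (aC (Order.compl b) (mem_last b [:: Order.compl b])).
by split=> [/(m.1)/(mb.2)|/(mb.1)/(m.2)].
Qed.

Lemma below_deciding (C : seq B) (b : B) : b <> \bot%O ->
  exists a, [/\ a <> \bot%O, (a <= b)%O &
    forall c, c \in C -> (a <= c)%O \/ (a <= Order.compl c)%O].
Proof.
elim: C b => [|c C IH] b b0; first by exists b.
have [bc|bc] := pselect (Order.meet b c = \bot%O).
  have [a [a0 ab aC]] := IH b b0; exists a; split=> // c'.
  rewrite in_cons => /predU1P[->|/aC //]; right; apply: le_trans ab _.
  by rewrite -disj_leC; apply/eqP.
have [a [a0 ab aC]] := IH _ bc; exists a; split=> //; first exact: le_trans ab (leIl _ _).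
move=> c'; rewrite in_cons => /predU1P[->|/aC //]; left; exact: le_trans ab (leIr _ _).
Qed.

(** Below b, a nonzero a decides the elements of C.  On a finite set s which separates
the codes of the functions and of the elements in question, the prescribed values
of the functions and the ultrafilter given by a can be written into a point. *)
Lemma base_independent : independent value member base set0.
Proof.
move=> b e h A b0 _ [s0 [C AP]].
have [a [a0 ab aC]] := below_deciding C b0.
have [s1 s1P] := traces_separate (e ++ [seq z c | c <- b :: C]).
pose s := s0 `|` s1; have {}s1P := s1P s (fsubsetUr _ _).
pose up := [seq c <- b :: C | (a <= c)%O].
have [t tE] := pt_surj (s, [seq (trace Z s, h Z) | Z <- e], [seq trace (z c) s | c <- up]).
have mem_up c : c \in b :: C -> (a <= c)%O -> member c t.
  move=> cC ac; rewrite /member /mkset tE /=.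
  by apply/mapP; exists c => //; rewrite mem_filter ac.
have up_mem c : c \in b :: C -> member c t -> (a <= c)%O.
  move=> cC; rewrite /member /mkset tE /= => /mapP[c']; rewrite mem_filter => /andP[ac' c'C].
  by move=> /s1P/zinj->; rewrite // mem_cat; apply/orP; right; apply: map_f.
exists t; split.
  split; first by apply: mem_up; rewrite ?mem_head.
  move=> Z Ze; rewrite /value tE /=.
  apply: (@lookup_map _ (trace^~ s)) => // Y Y' Ye Y'e.
  by apply: s1P; rewrite mem_cat ?Ye ?Y'e.
apply: AP; first by rewrite tE /= fsubsetUl.
exists a => // c cC; have cbC : c \in b :: C by rewrite in_cons cC orbT.
have [ac|ac] := aC c cC; first by left; split=> //; exact: mem_up.
right; split=> // /(up_mem _ cbC) ac'; apply: a0; apply/eqP.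
by rewrite -lex0 -(meetxC c) lexI ac'.
Qed.

Lemma base_point (x : L) : base [set t | x \in (pt t).1.1].
Proof. by exists [fset x], [::] => t; rewrite fsub1set. Qed.

End Base.

(** * Room for all tasks *)

Lemma embeds_retract (X Y : Type) (x0 : X) : embeds X Y ->
  exists p : Y -> X, forall x, exists y, p y = x.
Proof.
move=> [f fi].
have /choice[p pP] : forall y, exists x, forall x', f x' = y -> x = x'.
  move=> y; have [[x <-]|no] := pselect (exists x, f x = y); first by exists x => x' /fi.
  by exists x0 => x' fx'; case: no; exists x'.
by exists p => x; exists (f x); exact: pP.
Qed.

Lemma embeds_fun_set (X Y L : Type) : embeds (X * Y) L -> embeds (X -> set Y) (set L).
Proof.
move=> [i ii]; exists (fun f => [set l | exists x y, f x y /\ i (x, y) = l]).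
have sub (f f' : X -> set Y) x : [set l | exists x y, f x y /\ i (x, y) = l] =
    [set l | exists x y, f' x y /\ i (x, y) = l] -> f x `<=` f' x.
  move=> ff' y fxy.
  have : [set l | exists x y, f x y /\ i (x, y) = l] (i (x, y)) by exists x, y.
  by rewrite ff' => -[x' [y' [fxy' /ii[<- <-]]]].
by move=> f f' ff'; apply/funext => x; apply/seteqP; split; apply: sub.
Qed.

(** If the sets [u v] covered [set L], then each of its elements would be determined by
a predecessor v of w and an element of L. *)
Lemma union_has_room (W L : Type) (R : W -> W -> Prop) (w : W) (u : W -> set (set L)) :
  embeds nat L -> ~ embeds (set L) {v | R v w} ->
  (forall v, R v w -> small L (u v)) -> exists Z, forall v, R v w -> ~ u v Z.
Proof.
move=> infL nseg usmall; apply: contrapT => full.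
have /choice[v vP] : forall Z, exists v : {v | R v w}, u (sval v) Z.
  move=> Z; apply: contrapT => nZ; apply: full; exists Z => v vw uZ.
  by apply: nZ; exists (exist _ v vw).
have [i _] := infL.
have /choice[f fP] : forall v : {v | R v w}, exists f : set L -> L,
    forall Z Z', u (sval v) Z -> u (sval v) Z' -> f Z = f Z' -> Z = Z'.
  by move=> v'; exact: usmall (svalP v').
apply: (small_product infL (@not_embeds_set L) nseg).
exists (fun Z => (v Z, f (v Z) Z)) => Z Z' [vv].
by rewrite -vv; apply: fP => //; rewrite vv.
Qed.

(** * The homomorphism *)

Section Quotient.
Variables (d : Order.disp_t) (B : ctbDistrLatticeType d) (I : Type).
Variables (X : B -> set I) (D : set_system I).
Hypotheses (FD : Filter D) (repD : represents X D).
Hypothesis posD : forall b A, b <> \bot%O -> D A -> X b `&` A !=set0.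

(** Otherwise [X (b `&` ~` c)] would be null modulo D. *)
Lemma represents_le_inv b c : D [set t | X b t -> X c t] -> (b <= c)%O.
Proof.
move=> bc; apply: contrapT => nbc.
have bc0 : Order.meet b (Order.compl c) <> \bot%O by move/eqP; rewrite disj_leC complK => /nbc.
have [t [Xt [/= h [[h1 _] [h2 _]]]]] :=
  posD bc0 (filterI bc (filterI (repD.1 b (Order.compl c)) (repD.2 c))).
by have [/h Xc /h2] := h1 Xt.
Qed.

Lemma represents_inj b c : eqm D (X b) (X c) -> b = c.
Proof.
move=> bc; apply/le_anti/andP; split; apply: represents_le_inv; apply: filterS bc => t /=;
by case.
Qed.

Lemma represents1 : D (X \top%O).
Proof.
apply: filterS (filterI (represents0 FD repD) (repD.2 \bot%O)) => t.
by rewrite compl0 => -[/= h [_]]; exact.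
Qed.

Lemma represents_join b c : eqm D (X (Order.join b c)) (X b `|` X c).
Proof.
rewrite -[Order.join b c]complK complU.
move: (repD.2 b) (repD.2 c) (repD.1 (Order.compl b) (Order.compl c))
  (repD.2 (Order.meet (Order.compl b) (Order.compl c))) => h1 h2 h3 h4.
apply: filterS (filterI (filterI h1 h2) (filterI h3 h4)) => t /=.
rewrite /setI /setU /setC /=.
have [Xb|] := pselect (X b t); have [Xc|] := pselect (X c t); tauto.
Qed.

Lemma quotient_morphism : (forall A, exists b, eqm D A (X b)) ->
  exists j : set I -> B, [/\ ba_morphism j, forall b, j (X b) = b &
    D = j @^-1` [set \top%O]].
Proof.
move=> /choice[j jP].
have jE A b : eqm D A (X b) -> j A = b.
  move=> Ab; apply: represents_inj; apply: filterS (filterI (jP A) Ab) => t /= [].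
  by rewrite /= => -> .
have j1 A : D A -> j A = \top%O.
  by move=> DA; apply: jE; apply: filterS (filterI DA represents1) => t [? ?].
exists j; split.
- split.
  + move=> A A'; apply: jE; apply: filterS (filterI (filterI (jP A) (jP A')) (repD.1 (j A) (j A'))).
    by move=> t /= [[h1 h2] h3]; apply: iff_trans (iff_sym h3); split=> -[/h1 ? /h2 ?].
  + move=> A A'; apply: jE.
    apply: filterS (filterI (filterI (jP A) (jP A')) (represents_join (j A) (j A'))).
    move=> t /= [[h1 h2] h3]; apply: iff_trans (iff_sym h3).
    by split=> -[/h1|/h2] ?; [left|right|left|right].
  + move=> A; apply: jE; apply: filterS (filterI (jP A) (repD.2 (j A))).
    move=> t /= [h1 h3]; apply: iff_trans (iff_sym h3).
    have : ~ A t <-> ~ X (j A) t by tauto.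
    exact.
  + by apply: jE; apply: filterS (represents0 FD repD) => t.
  + by apply: j1; exact: filterT.
- by move=> b; apply: jE; apply: filterE.
- apply/seteqP; split=> A; first exact: j1.
  move=> /= jA; apply: filterS (filterI (jP A) represents1) => t [/=].
  by rewrite jA => h /h.
Qed.

End Quotient.

(** * Existence of the filter and the homomorphism *)

Theorem theorem7p1 (M : Type) (L : choiceType)
    (d : Order.disp_t) (B : ctbDistrLatticeType d)
    (M_infinite : infinite_set [set: M])
    (M_le_L : ([set: M] #<= [set: L])%card)
    (B_nontrivial : nontrivial_ba B)
    (B_complete : complete_ba B)
    (B_cc : succ_cc B M)
    (B_card : ([set: B] #<= [set: set L])%card) :
  exists (D : pfilter_on L) (j : set L -> B),
    [/\ regular L D,
        excellent L D,
        ba_morphism j,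
        (forall b : B, exists A : set L, j A = b) &
        (D : set_system L) = j @^-1` [set \top%O]].
Proof.
have nat_le_L : ([set: nat] #<= [set: L])%card.
  by move/infiniteP: M_infinite => h; exact: card_le_trans h M_le_L.
have [l _] := infinite_setN0 ((infiniteP _).2 nat_le_L).
have infL : embeds nat L := embeds_card l nat_le_L.
have Bcc (S : set B) : antichain S -> small L S.
  by move=> /B_cc SM; apply: (card_le_inj l); exact: card_le_trans SM M_le_L.
have [z zinj] := embeds_card setT B_card.
have [pt pt_surj] := embeds_retract (fset0, [::], [::]) (embeds_point infL).
have [W [R [Rwo LW nseg]]] := initial_wellorder (set L).
have [task task_surj] : exists task : W -> {fset L} -> set L, forall f, exists w, task w = f.
  apply: (embeds_retract (fun=> setT)); apply: embeds_trans LW; apply: embeds_fun_set.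
  apply: embeds_trans (infinite_absorbs_square infL).
  by apply: embeds_prod (embeds_fset infL) _; exists id.
have room w (u : W -> set (set L)) : (forall v, R v w -> small L (u v)) ->
    exists Z, forall v, R v w -> ~ u v Z.
  exact: union_has_room infL (nseg w).
have [D [FD baseD posD handledD]] := handle_all task infL B_complete Bcc Rwo room
  (base_filter z pt) (base_represents z pt) (base_independent zinj pt_surj).
pose X := member z pt.
have repD : represents X D.
  by have [rI rC] := base_represents z pt; split=> [b c|b]; apply: baseD; [exact: rI|exact: rC].
have D0 : ~ D set0.
  by move=> D0; have [t []] := posD _ _ (fun e => B_nontrivial (esym e)) D0.
(* The constant family at A: if it is refined, then A is in D. *)
have value_exists A : exists b, eqm D A (X b).
  have [w wA] := task_surj (fun=> A).
  have := handledD w; rewrite wA => -[[r rD]|[_ [b [_ Ab]]]]; last by exists b.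
  exists \top%O; apply: filterS (filterI (rD fset0) (represents1 FD repD)) => t [/= [_ ?] ?].
  by split.
have [j [jm jX jD]] := quotient_morphism FD repD posD value_exists.
exists (PFilterType D D0), j; split=> //.
- exists (fun x => [set t | x \in (pt t).1.1]); split=> [x|t].
    exact/baseD/base_point.
  exact: finite_fset.
(* A family f of sets of D has been refined: in the other case, X b would be in D for
   some b <> 1. *)
- apply: good_excellent => f Df; have [w wf] := task_surj f.
  have := handledD w; rewrite wf => -[//|[v [b [b1 fb]]]].
  have DXb : D (X b) by apply: filterS (filterI (Df v) fb) => t /= [? h]; apply/h.
  by case: b1; rewrite -(jX b); move: DXb; rewrite jD.
- by move=> b; exists (X b).
Qed.
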